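(* Let $\mathbb{C}[x,y]$ denote the free associative unital $\mathbb{C}$-algebra in two non-commuting variables $x,y$, and let $$N=\frac{\mathbb{C}[x,y]}{\langle xy+yx,\; x^3+y^2,\; y^3\rangle}.$$ Then $N$ deforms into $A=M_2(\mathbb{C})\oplus\mathbb{C}^{\oplus 5}$.
   Context: A formal deformation of a $\mathbb{C}$-algebra $N$ is an associative $\mathbb{C}[t]$-bilinear multiplication $\ast$ on the $\mathbb{C}[t]$-module $N[t]$ which at $t=0$ specializes to the multiplication of $N$; it is determined by the products $a\ast b=\sum_{i\ge 0}\mu_i(a\otimes b)t^i\in N[t]$ for $a,b\in N$ (a finite sum), where $\mu_0$ is the product of $N$ and $\mu_i:N\otimes N\to N$ are $\mathbb{C}$-linear. For $s\in\mathbb{C}$, $N_s$ denotes the algebra with underlying vector space $N$ and product $a\ast_s b=\sum_{i\ge0}\mu_i(a\otimes b)s^i$ (so $N_0=N$). ''$N$ deforms into $A$'' means that there is a formal deformation of $N$ such that $A$ is isomorphic as a $\mathbb{C}$-algebra to $N_s$ for some $s\in\mathbb{C}\setminus\{0\}$. Here $M_2(\mathbb{C})$ is the algebra of $2\times 2$ complex matrices and $M_2(\mathbb{C})\oplus\mathbb{C}^{\oplus5}$ is the direct product algebra. *)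

(* Defs.v *)
From HB Require Import structures.
From mathcomp Require Import all_boot all_order all_algebra.
From mathcomp Require Import boolp classical_sets reals.
From mathcomp Require Import complex finmap monalg.

Set Implicit Arguments.
Unset Strict Implicit.
Unset Printing Implicit Defensive.

Import GRing.Theory.
Local Open Scope ring_scope.
Local Open Scope quotient_scope.

(* The library only makes a monoid algebra an [algType] when the monoid is
   commutative, hence the alias and the instance below. *)
Definition free_algebra (K : comNzRingType) (I : choiceType) : Type :=
  {malg K[{fmonom I}]}.

Definition free_var (K : comNzRingType) (I : choiceType) (i : I) :
  free_algebra K I := << fmu i >>%R.

Section FreeAlgebra.
Variables (K : comNzRingType) (I : choiceType).

Lemma free_algebra_scaleAr (k : K) (u v : {malg K[{fmonom I}]}) :
  k *: (u * v) = u * (k *: v).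
Proof.
apply/malgP => m; rewrite mcoeffZ.
rewrite (mcoeffMlw m (fsubset_refl (msupp u)) (fsubset_refl (msupp v))).
rewrite (mcoeffMlw m (fsubset_refl (msupp u)) (msuppZ_le k v)).
rewrite mulr_sumr; apply: eq_bigr => i _.
rewrite mulr_sumr; apply: eq_bigr => j _.
by rewrite mcoeffZ mulrnAr mulrCA.
Qed.

HB.instance Definition _ := GRing.Lalgebra.on (free_algebra K I).
HB.instance Definition _ :=
  GRing.Lalgebra_isAlgebra.Build K (free_algebra K I) free_algebra_scaleAr.

End FreeAlgebra.

(* Quotient of an algebra by a two-sided ideal.  [ring_quotient] only builds
   quotients of commutative rings, and its [idealr] are the proper ideals that
   are stable under multiplication on the left. *)
HB.mixin Record isRightAbsorbing (R : nzRingType) (S : R -> bool) := {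
  right_absorbing_subproof : forall a : R, {in S, forall u, u * a \in S}
}.

#[short(type="ideal2")]
HB.structure Definition Ideal2 (R : nzRingType) :=
  {S of Idealr R S & isRightAbsorbing R S}.

Definition alg_quot (K : comNzRingType) (F : algType K) (I : ideal2 F) : Type :=
  Quotient.quot I.

Section AlgQuotient.
Variables (K : comNzRingType) (F : algType K) (I : ideal2 F).
Local Notation Q := (alg_quot I).

HB.instance Definition _ := GRing.Zmodule.on Q.
HB.instance Definition _ := Quotient.on Q.

Lemma alg_quot_eqP (u v : F) : reflect (\pi_Q u = \pi_Q v) (u - v \in I).
Proof.
have -> : (u - v \in I) = (\pi_Q u == \pi_Q v) by exact: Quotient.idealrBE.
exact: eqP.
Qed.

Definition alg_quot_one : Q := lift_cst Q 1.
Definition alg_quot_mul : Q -> Q -> Q := lift_op2 Q *%R.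
Definition alg_quot_scale (k : K) : Q -> Q := lift_op1 Q ( *:%R k).

Lemma alg_quot_pi1 : \pi_Q 1 = alg_quot_one.
Proof. by rewrite /alg_quot_one; unlock. Qed.

Lemma alg_quot_piD (u v : F) : \pi_Q (u + v) = \pi_Q u + \pi_Q v :> Q.
Proof. exact: Quotient.pi_add. Qed.

Lemma alg_quot_piM (u v : F) :
  \pi_Q (u * v) = alg_quot_mul (\pi_Q u) (\pi_Q v).
Proof.
unlock alg_quot_mul; apply/alg_quot_eqP; set u' := repr _; set v' := repr _.
have -> : u * v - u' * v' = (u - u') * v + u' * (v - v').
  by rewrite mulrBl mulrBr addrA subrK.
have uI : u - u' \in I by apply/alg_quot_eqP; rewrite /u' reprK.
have vI : v - v' \in I by apply/alg_quot_eqP; rewrite /v' reprK.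
by rewrite rpredD ?(right_absorbing_subproof v _ uI) // idealMr.
Qed.

Lemma alg_quot_piZ (k : K) (u : F) :
  \pi_Q (k *: u) = alg_quot_scale k (\pi_Q u).
Proof.
unlock alg_quot_scale; apply/alg_quot_eqP; rewrite -scalerBr -mulr_algl idealMr //.
by apply/alg_quot_eqP; rewrite reprK.
Qed.

Lemma alg_quot_mulA : associative alg_quot_mul.
Proof.
by move=> x y z; rewrite -[x]reprK -[y]reprK -[z]reprK -!alg_quot_piM mulrA.
Qed.

Lemma alg_quot_mul1l : left_id alg_quot_one alg_quot_mul.
Proof. by move=> x; rewrite -[x]reprK -alg_quot_pi1 -alg_quot_piM mul1r. Qed.

Lemma alg_quot_mul1r : right_id alg_quot_one alg_quot_mul.
Proof. by move=> x; rewrite -[x]reprK -alg_quot_pi1 -alg_quot_piM mulr1. Qed.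

Lemma alg_quot_mulDl : left_distributive alg_quot_mul +%R.
Proof.
move=> x y z; rewrite -[x]reprK -[y]reprK -[z]reprK.
by rewrite -alg_quot_piD -!alg_quot_piM -alg_quot_piD mulrDl.
Qed.

Lemma alg_quot_mulDr : right_distributive alg_quot_mul +%R.
Proof.
move=> x y z; rewrite -[x]reprK -[y]reprK -[z]reprK.
by rewrite -alg_quot_piD -!alg_quot_piM -alg_quot_piD mulrDr.
Qed.

Lemma alg_quot_pi0 : \pi_Q 0 = 0 :> Q.
Proof. by apply: (@addrI _ (\pi_Q 0)); rewrite -alg_quot_piD !addr0. Qed.

Lemma alg_quot_oner_neq0 : alg_quot_one != 0.
Proof.
by rewrite -alg_quot_pi0 -alg_quot_pi1; apply/eqP => /alg_quot_eqP; rewrite subr0 idealr1.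
Qed.

HB.instance Definition _ := GRing.Zmodule_isNzRing.Build Q
  alg_quot_mulA alg_quot_mul1l alg_quot_mul1r alg_quot_mulDl alg_quot_mulDr
  alg_quot_oner_neq0.

Lemma alg_quot_scaleA a b (u : Q) :
  alg_quot_scale a (alg_quot_scale b u) = alg_quot_scale (a * b) u.
Proof. by rewrite -[u]reprK -!alg_quot_piZ scalerA. Qed.

Lemma alg_quot_scale1 : left_id 1 alg_quot_scale.
Proof. by move=> u; rewrite -[u]reprK -alg_quot_piZ scale1r. Qed.

Lemma alg_quot_scaleDr : right_distributive alg_quot_scale +%R.
Proof.
move=> a u v; rewrite -[u]reprK -[v]reprK.
by rewrite -alg_quot_piD -!alg_quot_piZ -alg_quot_piD scalerDr.
Qed.

Lemma alg_quot_scaleDl u : {morph alg_quot_scale^~ u : a b / a + b}.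
Proof.
by move=> a b; rewrite -[u]reprK -!alg_quot_piZ -alg_quot_piD scalerDl.
Qed.

HB.instance Definition _ := GRing.Zmodule_isLmodule.Build K Q
  alg_quot_scaleA alg_quot_scale1 alg_quot_scaleDr alg_quot_scaleDl.

Lemma alg_quot_scaleAl (k : K) (u v : Q) : k *: (u * v) = k *: u * v.
Proof.
change (alg_quot_scale k (alg_quot_mul u v) =
        alg_quot_mul (alg_quot_scale k u) v).
by rewrite -[u]reprK -[v]reprK -!(alg_quot_piM, alg_quot_piZ) scalerAl.
Qed.

HB.instance Definition _ :=
  GRing.Lmodule_isLalgebra.Build K Q alg_quot_scaleAl.

Lemma alg_quot_scaleAr (k : K) (u v : Q) : k *: (u * v) = u * (k *: v).
Proof.
change (alg_quot_scale k (alg_quot_mul u v) =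
        alg_quot_mul u (alg_quot_scale k v)).
by rewrite -[u]reprK -[v]reprK -!(alg_quot_piM, alg_quot_piZ) scalerAr.
Qed.

HB.instance Definition _ :=
  GRing.Lalgebra_isAlgebra.Build K Q alg_quot_scaleAr.

End AlgQuotient.

Section GeneratedIdeal.
Local Open Scope classical_set_scope.

Definition two_sided_ideal (R : nzRingType) (J : set R) : Prop :=
  [/\ J 0,
      forall u v, J u -> J v -> J (u - v),
      forall a u, J u -> J (a * u)
    & forall u a, J u -> J (u * a)].

Definition ideal_gen (R : nzRingType) (G : set R) (u : R) : bool :=
  `[< smallest (@two_sided_ideal R) G u >].

Variables (R : nzRingType) (G : set R).

Lemma ideal_genP (u : R) :
  reflect (forall J, two_sided_ideal J -> G `<=` J -> J u) (u \in ideal_gen G).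
Proof.
apply: (iffP (asboolP _)) => [h J J2 GJ|h J [J2 GJ]]; first exact: h.
exact: h.
Qed.

Lemma ideal_gen_zmod_closed : zmod_closed (ideal_gen G).
Proof.
split=> [|u v /ideal_genP hu /ideal_genP hv]; apply/ideal_genP => J J2 GJ.
  by case: J2.
by case: (J2) => _ JB _ _; apply: JB; [exact: hu | exact: hv].
Qed.

Lemma ideal_genMl a : {in ideal_gen G, forall u, a * u \in ideal_gen G}.
Proof.
move=> u /ideal_genP hu; apply/ideal_genP => J J2 GJ.
by case: (J2) => _ _ Jl _; apply: Jl; exact: hu.
Qed.

Lemma ideal_genMr a : {in ideal_gen G, forall u, u * a \in ideal_gen G}.
Proof.
move=> u /ideal_genP hu; apply/ideal_genP => J J2 GJ.
by case: (J2) => _ _ _ Jr; apply: Jr; exact: hu.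
Qed.

End GeneratedIdeal.

Section AlgebraN.
Variable K : comNzRingType.

Local Notation x := (free_var K (ord0 : 'I_2)).
Local Notation y := (free_var K (ord_max : 'I_2)).

Definition N_relations : set (free_algebra K 'I_2) :=
  [set x * y + y * x; x ^+ 3 + y ^+ 2; y ^+ 3]%classic.

Definition N_ideal : free_algebra K 'I_2 -> bool := ideal_gen N_relations.

(* Every element of the ideal has constant coefficient 0. *)
Lemma N_ideal1 : 1 \notin N_ideal.
Proof.
pose ev : {rmorphism {malg K[{fmonom 'I_2}]} -> K} :=
  @mcoeff {fmonom 'I_2} K (@mone {fmonom 'I_2}).
apply/negP => /ideal_genP /(_ (fun u => ev u = 0)) h.
have ev0 (i : 'I_2) : ev (free_var K i) = 0.
  by rewrite /ev /free_var /= mcoeffU; case: eqP => // /(congr1 (@fmonom_val _));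
     rewrite fm1 fmuE.
have evx := ev0 ord0; have evy := ev0 ord_max.
suff J2 : two_sided_ideal (fun u => ev u = 0).
  suff /(h J2)/eqP : (N_relations `<=` (fun u => ev u = 0))%classic.
    by rewrite rmorph1 oner_eq0.
  move=> _ [[->|->]|->] /=.
  - by rewrite rmorphD !rmorphM /= evx evy !mul0r addr0.
  - by rewrite rmorphD !rmorphXn /= evx evy !expr0n addr0.
  - by rewrite rmorphXn /= evy expr0n.
split=> [|u v u0 v0|a u u0|u a u0].
- exact: rmorph0.
- by rewrite rmorphB u0 v0 subr0.
- by rewrite rmorphM u0 mulr0.
- by rewrite rmorphM u0 mul0r.
Qed.

HB.instance Definition _ :=
  GRing.isZmodClosed.Build (free_algebra K 'I_2) N_ideal
  (ideal_gen_zmod_closed N_relations).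
HB.instance Definition _ := isProperIdeal.Build (free_algebra K 'I_2) N_ideal
  (conj N_ideal1 (@ideal_genMl _ N_relations)).
HB.instance Definition _ := isRightAbsorbing.Build (free_algebra K 'I_2) N_ideal
  (@ideal_genMr _ N_relations).

Definition algN : algType K := alg_quot N_ideal.

End AlgebraN.

Section FormalDeformation.
Variables (K : comNzRingType) (N : algType K).

(* The K[t]-module structure of N[t]. *)
Definition poly_scale (p : {poly K}) (u : {poly N}) : {poly N} :=
  map_poly (in_alg N) p * u.

Record formal_deformation (mu : {poly N} -> {poly N} -> {poly N}) : Prop := {
  deform_linear_l : forall p u u' v,
    mu (poly_scale p u + u') v = poly_scale p (mu u v) + mu u' v;
  deform_linear_r : forall p u v v',
    mu u (poly_scale p v + v') = poly_scale p (mu u v) + mu u v';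
  deform_assoc : associative mu;
  deform_at0 : forall u v, (mu u v).[0] = u.[0] * v.[0]
}.

(* The product of the algebra N_s. *)
Definition deformed_mul (mu : {poly N} -> {poly N} -> {poly N}) (s : K)
    (a b : N) : N :=
  let ab := mu a%:P b%:P in \sum_(i < size ab) s ^+ i *: ab`_i.

(* An isomorphism onto N_s is a linear bijection onto the vector space N that
   turns the product of A into that of N_s; units are then preserved. *)
Definition deforms_into (A : algType K) : Prop :=
  exists mu, formal_deformation mu /\
  exists s : K, s != 0 /\
  exists phi : {linear A -> N}, bijective phi /\
    forall a b, phi (a * b) = deformed_mul mu s (phi a) (phi b).

End FormalDeformation.

(* Here [K^o] is [K] as an algebra over itself; products are componentwise. *)
Definition algA (K : comNzRingType) : algType K :=
  ('M[K]_2 * (K^o * K^o * K^o * K^o * K^o))%type.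

(* Main.v *)
From HB Require Import structures.
Require Import Defs.
From mathcomp Require Import all_boot all_order all_algebra.
From mathcomp Require Import reals complex.
From mathcomp Require Import boolp finmap monalg separable ring.

Set Implicit Arguments.
Unset Strict Implicit.
Unset Printing Implicit Defensive.

Import GRing.Theory Num.Theory.
Local Open Scope ring_scope.
Local Open Scope quotient_scope.

(** The algebra A = M_2(K) + K^5 is itself generated by two elements x, y for
which xy + yx = 2, x^3 + y^2 = 0 and y^3 = - x^2.  Give x degree 2 and y
degree 3.  The terms of top degree of these relations are the defining relations
of N, so N should be the graded algebra associated with the corresponding
filtration of A, and a filtered algebra is a deformation of its associated
graded algebra through the Rees construction.

In detail: in A[t] the elements X = x t^2 and Y = y t^3 satisfy
- XY + YX = 2 t^5,  X^3 + Y^2 = 0,  Y^3 = - t^5 X^2.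
Rewriting with these relations shows that the K[t]-span of the nine monomials
X^i Y^j (i, j < 3) is closed under products ([spannedM]).  When the x^i y^j form
a basis of A the X^i Y^j are linearly independent over K[t], so this span is a
free K[t]-lattice of rank 9 in A[t], stable under products.  At t = 1 it becomes
A; at t = 0 its relations become those of N.  Identifying it with N[t] along
monomials transports its product to N[t], which is the wanted deformation
([deforms_into_of_lattice], [deforms_into_of_generators]).

Two bases have to be established.
- In N the nine monomials span by the same rewriting.  They are independent
  because the ideal of relations is mapped into t times the lattice, whereas a
  nonzero combination of monomials with coefficients in K is not ([nfN_inj]).
- In A, 1-dimensional representations of the relations have y = 1/x and
  x^5 = -1, which gives five points; there is also a 2-dimensional one,
  x = E_12, y = 2 E_21.  Evaluation at these six representations is A, and the
  nine monomials are independent there because a polynomial of degree at most 4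
  with five roots vanishes ([gen_inj]). *)

(** * The relations and their normal forms *)

(** The one-parameter family that contains the relations of N (c = 0), those of
the generators of A (c = 1) and those of the Rees algebra (c = t^5).  The last
relation makes the first two confluent: commuting y with x^3 = - y^2 produces
it, up to a factor 2. *)
Definition family_rel (S : nzRingType) (c x y : S) : Prop :=
  [/\ x * y + y * x = c *+ 2, x ^+ 3 + y ^+ 2 = 0 & y ^+ 3 = - (c * x ^+ 2)].

Section NormalForms.
Variables (L : comNzRingType) (S : nzRingType) (rho : {rmorphism L -> S}).
Variables (x y : S).

(** The scalars come through a ring morphism instead of an algebra structure, so
that one development serves N and A over K, A[t] over K[t], and a product of
rings over K[t]. *)
Definition nf (a : 'M[L]_3) : S :=
  \sum_i \sum_j rho (a i j) * (x ^+ i * y ^+ j).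

Definition spanned (s : S) : Prop := exists a, nf a = s.

Lemma nf_is_zmod_morphism : zmod_morphism nf.
Proof.
move=> a b; rewrite /nf -sumrB; apply: eq_bigr => i _.
rewrite -sumrB; apply: eq_bigr => j _.
by rewrite !mxE rmorphB mulrBl.
Qed.

HB.instance Definition _ :=
  GRing.isZmodMorphism.Build 'M[L]_3 S nf nf_is_zmod_morphism.

Lemma nfZ p a : nf (p *: a) = rho p * nf a.
Proof.
rewrite /nf mulr_sumr; apply: eq_bigr => i _.
rewrite mulr_sumr; apply: eq_bigr => j _.
by rewrite mxE rmorphM -mulrA.
Qed.

Lemma nf_delta i j : nf (delta_mx i j) = x ^+ i * y ^+ j.
Proof.
rewrite /nf (bigD1 i) //= (bigD1 j) //= !mxE !eqxx rmorph1 mul1r.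
rewrite big1 => [|k /negPf kj]; last by rewrite mxE kj andbF rmorph0 mul0r.
rewrite addr0 big1 ?addr0 // => k /negPf ki.
by rewrite big1 // => l _; rewrite mxE ki rmorph0 mul0r.
Qed.

Lemma spanned_mon i j : (i < 3)%N -> (j < 3)%N -> spanned (x ^+ i * y ^+ j).
Proof.
by move=> hi hj; exists (delta_mx (Ordinal hi) (Ordinal hj)); rewrite nf_delta.
Qed.

Lemma spannedD s s' : spanned s -> spanned s' -> spanned (s + s').
Proof. by move=> [a <-] [b <-]; exists (a + b); rewrite raddfD. Qed.

Lemma spannedB s s' : spanned s -> spanned s' -> spanned (s - s').
Proof. by move=> [a <-] [b <-]; exists (a - b); rewrite raddfB. Qed.

Lemma spanned_rho p s : spanned s -> spanned (rho p * s).
Proof. by move=> [a <-]; exists (p *: a); rewrite nfZ. Qed.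

Lemma spanned0 : spanned 0.
Proof. by exists 0; rewrite raddf0. Qed.

Lemma spannedN s : spanned s -> spanned (- s).
Proof. by rewrite -sub0r; apply: spannedB spanned0. Qed.

Lemma spanned1 : spanned 1.
Proof. by have := @spanned_mon 0 0 isT isT; rewrite !expr0 mulr1. Qed.

Hypothesis rhoC : forall p s, rho p * s = s * rho p.

Lemma spanned_mul_of_mon (z : S) :
  (forall i j, (i < 3)%N -> (j < 3)%N -> spanned (z * (x ^+ i * y ^+ j))) ->
  forall s, spanned s -> spanned (z * s).
Proof.
move=> hz _ [a <-]; rewrite /nf mulr_sumr.
elim/big_ind: _ => [||i _]; [exact: spanned0 | exact: spannedD |].
rewrite mulr_sumr; elim/big_ind: _ => [||j _].
- exact: spanned0.
- exact: spannedD.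
by rewrite mulrA -rhoC -mulrA; apply/spanned_rho/hz.
Qed.

Variable c : L.
Hypothesis rel : family_rel (rho c) x y.

Lemma spanned_mulx s : spanned s -> spanned (x * s).
Proof.
case: rel => _ x3E y3E.
apply: spanned_mul_of_mon => i j; rewrite mulrA -exprS.
case: i => [|[|[|//]]] _ hj; [exact: spanned_mon | exact: spanned_mon |].
have -> : x ^+ 3 = - y ^+ 2 by apply/eqP; rewrite -addr_eq0 x3E.
rewrite mulNr -exprD; apply: spannedN; case: j hj => [|j] hj.
  by have := @spanned_mon 0 2 isT isT; rewrite expr0 mul1r.
rewrite (addnS 2 j) -addSn exprD y3E mulNr -mulrA.
by apply/spannedN/spanned_rho/spanned_mon => //; apply: ltnW.
Qed.

Lemma spanned_muly s : spanned s -> spanned (y * s).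
Proof.
case: rel => xyE _ y3E.
have yxE : y * x = rho c *+ 2 - x * y by rewrite -xyE (addrC (x * y)) addrK.
have spy j : (j < 4)%N -> spanned (y ^+ j).
  rewrite ltnS leq_eqVlt => /predU1P [->|hj].
    rewrite y3E; apply/spannedN/spanned_rho.
    by have := @spanned_mon 2 0 isT isT; rewrite expr0 mulr1.
  by have := @spanned_mon 0 j isT hj; rewrite expr0 mul1r.
(* the corrections 2 c x produced by moving y past each factor x cancel *)
have yx2E : y * x ^+ 2 = x ^+ 2 * y.
  rewrite !expr2 mulrA yxE mulrBl -(mulrA x y) yxE mulrBr !mulrA.
  by rewrite mulrnAl mulrnAr -rhoC opprB addrC subrK.
apply: spanned_mul_of_mon => i j; rewrite mulrA.
case: i => [|[|[|//]]] _ hj.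
- by rewrite expr0 mulr1 -exprS; apply: spy.
- rewrite expr1 yxE mulrBl -mulrA -exprS -mulr_natl -(rmorph_nat rho) -mulrA.
  apply: spannedB; last exact/spanned_mulx/spy.
  by do 2 apply: spanned_rho; apply/spy/ltnW.
- rewrite yx2E -mulrA -exprS expr2 -mulrA.
  by do 2 apply: spanned_mulx; apply: spy.
Qed.

(** The span contains 1 and is stable under left multiplication by [x] and [y],
hence by every monomial; so it is a subring. *)
Lemma spannedM s s' : spanned s -> spanned s' -> spanned (s * s').
Proof.
move=> [a <-] hs'; rewrite /nf mulr_suml.
elim/big_ind: _ => [||i _]; [exact: spanned0 | exact: spannedD |].
rewrite mulr_suml; elim/big_ind: _ => [||j _].
- exact: spanned0.
- exact: spannedD.
rewrite -!mulrA; apply: spanned_rho.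
elim: (nat_of_ord i) => [|n IH]; last first.
  by rewrite exprS -mulrA; apply: spanned_mulx.
rewrite expr0 mul1r.
elim: (nat_of_ord j) => [|n IH]; last first.
  by rewrite exprS -mulrA; apply: spanned_muly.
by rewrite expr0 mul1r.
Qed.

End NormalForms.

Lemma rmorph_nf (L : comNzRingType) (S S' : nzRingType)
    (rho : {rmorphism L -> S}) (rho' : {rmorphism L -> S'})
    (f : {rmorphism S -> S'}) (x y : S) (a : 'M[L]_3) :
  (forall p, f (rho p) = rho' p) ->
  f (nf rho x y a) = nf rho' (f x) (f y) a.
Proof.
move=> frho; rewrite /nf rmorph_sum; apply: eq_bigr => i _.
rewrite rmorph_sum; apply: eq_bigr => j _.
by rewrite !rmorphM /= !rmorphXn frho.
Qed.

Lemma nf_comp (L L' : comNzRingType) (S : nzRingType)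
    (g : {rmorphism L -> L'}) (f : {rmorphism L' -> S}) (x y : S) a :
  nf (f \o g) x y a = nf f x y (map_mx g a).
Proof.
by apply: eq_bigr => i _; apply: eq_bigr => j _; rewrite mxE.
Qed.

Lemma in_algC (K : comNzRingType) (A : algType K) k (s : A) :
  in_alg A k * s = s * in_alg A k.
Proof. by rewrite /= mulr_algl mulr_algr. Qed.

Lemma nf_linear (K : comNzRingType) (A : algType K) (x y : A) :
  linear (nf (in_alg A) x y).
Proof. by move=> k a b; rewrite raddfD /= nfZ /= mulr_algl. Qed.

(** * Free algebras and quotients *)

Section FreeAlgebraUniversal.
Variables (K : comNzRingType) (I : choiceType).

Lemma free_algebra_ind (P : free_algebra K I -> Prop) :
  P 1 -> (forall u v, P u -> P v -> P (u + v)) ->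
  (forall k u, P u -> P (k *: u)) ->
  (forall i u, P u -> P (free_var K i * u)) -> forall u, P u.
Proof.
move=> P1 PD PZ PM u.
have P0 : P 0 by rewrite -(scale0r 1); apply: PZ.
rewrite (monalgE u); apply: big_ind => // m _.
have -> : << mcoeff m u *g m >> = mcoeff m u *: (<< m >> : free_algebra K I).
  by apply/malgP => n; rewrite mcoeffZ !mcoeffU mulr_natr.
apply: PZ; case: m => s; elim: s => [|i s IH].
  suff -> : << FMonom [::] >> = 1 :> free_algebra K I by [].
  by congr (<< _ >>); apply/eqP; rewrite -val_eqE /= fm1.
have -> : << FMonom (i :: s) >> =
    free_var K i * << FMonom s >> :> free_algebra K I.
  rewrite /free_var [RHS]fgmulUU mulr1; congr (<< _ >>).
  by apply/eqP; rewrite -val_eqE /= fmM fmU.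
exact: PM.
Qed.

(** The universal property.  The target is a ring with a central image of the
scalars, which covers A[t] with scalars acting through K[t]. *)
Lemma free_algebra_lift (S : nzRingType) (f : {rmorphism K -> S}) (v : I -> S) :
  (forall k s, f k * s = s * f k) ->
  exists ev : {rmorphism free_algebra K I -> S},
    (forall k, ev k%:A = f k) /\ (forall i, ev (free_var K i) = v i).
Proof.
move=> fC.
pose h (m : {fmonom I}) : S := \prod_(i <- m) v i.
have hM : monalg.mmorphism h.
  split=> [m n|]; last by rewrite /h fm1 big_nil.
  by rewrite /h fmM big_cat.
pose hm : {mmorphism {fmonom I} -> S} :=
  HB.pack h (monalg.isMultiplicative.Build _ _ h hM).
have evM : multiplicative (mmap f hm).
  by apply: commr_mmap_is_multiplicative => g m m'; apply: fC.
pose ev : {rmorphism free_algebra K I -> S} :=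
  HB.pack (mmap f hm : free_algebra K I -> S)
    (GRing.isZmodMorphism.Build _ _ _ (@mmap_is_additive _ _ _ f hm))
    (GRing.isMonoidMorphism.Build _ _ (mmap f hm) (evM.2, evM.1)).
exists ev; split=> [k|i].
  apply: etrans (@mmapZ _ _ _ f hm k 1) _.
  by rewrite [mmap _ _ _]evM.2 mulr1.
by rewrite /= mmapU [X in X * _](rmorph1 f) mul1r /h fmU big_seq1.
Qed.
End FreeAlgebraUniversal.

Lemma ord2E (i : 'I_2) : i = ord0 \/ i = ord_max.
Proof. by case: i => [[|[|//]] i2]; [left | right]; apply: val_inj. Qed.

(** Only left multiplication by the generators is involved here, so the image of
the whole free algebra lies in the span as soon as 1 does. *)
Lemma spanned_free_algebra (K L : comNzRingType) (S : nzRingType)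
    (rho : {rmorphism L -> S}) (g : K -> L) (c : L) (x y : S)
    (ev : {rmorphism free_algebra K 'I_2 -> S}) :
  (forall p s, rho p * s = s * rho p) -> family_rel (rho c) x y ->
  (forall k, ev k%:A = rho (g k)) ->
  ev (free_var K ord0) = x -> ev (free_var K ord_max) = y ->
  forall u, spanned rho x y (ev u).
Proof.
move=> rhoC rel evC evx evy.
elim/free_algebra_ind => [|u v hu hv|k u hu|i u hu].
- by rewrite rmorph1; apply: spanned1.
- by rewrite rmorphD; apply: spannedD.
- by rewrite -mulr_algl rmorphM evC; apply: spanned_rho.
- rewrite rmorphM; have [->|->] := ord2E i.
    by rewrite evx; apply: spanned_mulx rel _ hu.
  by rewrite evy; apply: spanned_muly rel _ hu.
Qed.

Section QuotientMap.
Variables (K : comNzRingType) (F : algType K) (I : ideal2 F).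

Definition quot_map (u : F) : alg_quot I := \pi_(alg_quot I) u.

Lemma quot_map_is_zmod_morphism : zmod_morphism quot_map.
Proof.
move=> u v; apply: (addIr (quot_map v)).
by rewrite subrK -alg_quot_piD subrK.
Qed.

Lemma quot_map_is_monoid_morphism : monoid_morphism quot_map.
Proof.
split=> [|u v]; first exact: alg_quot_pi1.
exact: alg_quot_piM.
Qed.

HB.instance Definition _ :=
  GRing.isZmodMorphism.Build F (alg_quot I) quot_map quot_map_is_zmod_morphism.
HB.instance Definition _ :=
  GRing.isMonoidMorphism.Build F (alg_quot I) quot_map
    quot_map_is_monoid_morphism.

Lemma quot_mapZ k u : quot_map (k *: u) = k *: quot_map u.
Proof. exact: alg_quot_piZ. Qed.

Lemma quot_map_eq0 u : quot_map u = 0 -> u \in I.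
Proof.
by rewrite -(rmorph0 quot_map) => /alg_quot_eqP; rewrite subr0.
Qed.

Lemma quot_map_ideal u : u \in I -> quot_map u = 0.
Proof.
by move=> uI; rewrite -(rmorph0 quot_map); apply/alg_quot_eqP; rewrite subr0.
Qed.

Lemma quot_map_surj v : exists u, quot_map u = v.
Proof. by exists (repr v); rewrite /quot_map reprK. Qed.

End QuotientMap.

(** * The Rees lattice in A[t] *)

Definition rees_gen (A : nzRingType) (x : A) (d : nat) : {poly A} :=
  x%:P * 'X^d.

Section ReesGen.
Variable A : nzRingType.

(** Evaluation at a central point is multiplicative even if the coefficients do
not commute. *)
Definition horner1 (p : {poly A}) : A := p.[1].

Lemma horner1_is_zmod_morphism : zmod_morphism horner1.
Proof. by move=> p q; rewrite /horner1 hornerD hornerN. Qed.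

Lemma horner1_is_monoid_morphism : monoid_morphism horner1.
Proof.
split=> [|p q]; rewrite /horner1 ?hornerC // hornerM_comm //.
by rewrite /comm_poly mul1r mulr1.
Qed.

HB.instance Definition _ :=
  GRing.isZmodMorphism.Build {poly A} A horner1 horner1_is_zmod_morphism.
HB.instance Definition _ :=
  GRing.isMonoidMorphism.Build {poly A} A horner1 horner1_is_monoid_morphism.

Lemma horner1_rees (z : A) d : horner1 (rees_gen z d) = z.
Proof.
by rewrite /rees_gen rmorphM /= /horner1 hornerC hornerXn expr1n mulr1.
Qed.

Lemma rees_genM (z z' : A) d e :
  rees_gen z d * rees_gen z' e = rees_gen (z * z') (d + e).
Proof.
rewrite /rees_gen polyCM exprD -!mulrA; congr (_ * _).
by rewrite !mulrA (commr_polyXn _ d).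
Qed.

Lemma rees_genX (z : A) d n : rees_gen z d ^+ n = rees_gen (z ^+ n) (d * n).
Proof.
by rewrite /rees_gen exprMn_comm ?polyC_exp ?exprM //; apply: commr_polyXn.
Qed.

Lemma rees_genD (z z' : A) d :
  rees_gen z d + rees_gen z' d = rees_gen (z + z') d.
Proof. by rewrite /rees_gen polyCD mulrDl. Qed.

End ReesGen.

Section PolyExtension.
Variables (K : comNzRingType) (A : algType K).

Local Notation scal := (map_poly (in_alg A)).

Lemma scalC (p : {poly K}) (u : {poly A}) : scal p * u = u * scal p.
Proof.
apply/polyP => n; rewrite coefM coefMr; apply: eq_bigr => i _.
by rewrite coef_map in_algC.
Qed.

Lemma coef_nf (x y : A) (a : 'M[{poly K}]_3) n :
  (nf scal x%:P y%:P a)`_n = nf (in_alg A) x y (map_mx (coefp n) a).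
Proof.
rewrite /nf coef_sum; apply: eq_bigr => i _.
rewrite coef_sum; apply: eq_bigr => j _.
by rewrite -!polyC_exp -polyCM coefMC coef_map mxE.
Qed.

Lemma nf_poly_inj (x y : A) :
  injective (nf (in_alg A) x y) -> injective (nf scal x%:P y%:P).
Proof.
move=> nf_inj a b ab; apply/matrixP => i j; apply/polyP => n.
have /nf_inj/matrixP/(_ i j) : nf (in_alg A) x y (map_mx (coefp n) a) =
    nf (in_alg A) x y (map_mx (coefp n) b) by rewrite -!coef_nf ab.
by rewrite !mxE.
Qed.

Lemma nf_poly_surj (x y : A) :
  (forall s, spanned (in_alg A) x y s) ->
  forall u, spanned scal x%:P y%:P u.
Proof.
move=> sp; elim/poly_ind => [|u c [a <-]]; first exact: spanned0.
have [b <-] := sp c; apply: spannedD.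
  by exists ('X *: a); rewrite nfZ /= map_polyX commr_polyX.
exists (map_mx polyC b); rewrite -nf_comp.
rewrite (rmorph_nf (f := polyC)(rho' := scal \o polyC)) //= => k.
by rewrite map_polyC.
Qed.

(** The powers of t can be moved into the coefficients, which reduces statements
about the Rees generators to the constant polynomials [x%:P] and [y%:P]. *)
Lemma nf_rees (x y : A) d e (a : 'M[{poly K}]_3) :
  nf scal (rees_gen x d) (rees_gen y e) a =
  nf scal x%:P y%:P (\matrix_(i, j) (a i j * 'X^(d * i + e * j))).
Proof.
apply: eq_bigr => i _; apply: eq_bigr => j _.
rewrite mxE rmorphM /= map_polyXn -mulrA; congr (_ * _).
by rewrite !rees_genX rees_genM -!polyC_exp -polyCM -[RHS]commr_polyXn.
Qed.
End PolyExtension.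

Section Rees.
Variables (K : comNzRingType) (A : algType K) (x y : A).
Local Notation scal := (map_poly (in_alg A)).

Lemma nf_rees_inj d e :
  injective (nf (in_alg A) x y) ->
  injective (nf scal (rees_gen x d) (rees_gen y e)).
Proof.
move=> /nf_poly_inj nf_inj a b; rewrite !nf_rees => /nf_inj/matrixP ab.
apply/matrixP => i j; have := ab i j; rewrite !mxE => /polyP abn.
apply/polyP => n; have := abn (n + (d * i + e * j))%N.
by rewrite !coefMXn ltnNge leq_addl addnK.
Qed.

Lemma horner1_scal (p : {poly K}) : horner1 (scal p) = in_alg A p.[1].
Proof. by rewrite /horner1 -[1 in LHS](rmorph1 (in_alg A)) horner_map. Qed.

Lemma nf_rees_at1 d e (a : 'M[{poly K}]_3) :
  (nf scal (rees_gen x d) (rees_gen y e) a).[1] =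
  nf (in_alg A) x y (map_mx (horner_eval 1) a).
Proof.
rewrite -[LHS]/(horner1 _).
rewrite (rmorph_nf (f := @horner1 A) (rho' := in_alg A \o horner_eval 1)).
  by rewrite /= !horner1_rees nf_comp.
exact: horner1_scal.
Qed.

Lemma nf_poly_at1 (a : 'M[{poly K}]_3) :
  (nf scal x%:P y%:P a).[1] = nf (in_alg A) x y (map_mx (horner_eval 1) a).
Proof. by have := nf_rees_at1 0 0 a; rewrite /rees_gen !mulr1. Qed.

Lemma nf_poly_at0 (a : 'M[{poly K}]_3) :
  (nf scal x%:P y%:P a).[0] = nf (in_alg A) x y (map_mx (coefp 0) a).
Proof. by rewrite horner_coef0 coef_nf. Qed.

(** The relations with c = 1 become homogeneous of degrees 5, 6 and 9 once c is
given degree 5. *)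
Lemma rees_rel :
  family_rel 1 x y -> family_rel (scal 'X^5) (rees_gen x 2) (rees_gen y 3).
Proof.
rewrite /family_rel mul1r => -[xyE x3E y3E]; split.
- rewrite !rees_genM rees_genD xyE map_polyXn /rees_gen.
  by rewrite rmorphMn mulrnAl mul1r.
- by rewrite !rees_genX rees_genD x3E /rees_gen mul0r.
- rewrite !rees_genX y3E map_polyXn /rees_gen polyCN mulNr -commr_polyXn.
  by rewrite -mulrA -exprD.
Qed.
End Rees.

(** * Deformations from lattices *)

Section Degeneration.
Variables (K : comNzRingType) (N A : algType K).
Variables (phi : {linear A -> N}) (sigma : {poly N} -> {poly A}).
Hypothesis phi_bij : bijective phi.
Hypothesis sigma_inj : injective sigma.
Hypothesis sigma_linear : forall p u v,
  sigma (poly_scale p u + v) = poly_scale p (sigma u) + sigma v.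
Hypothesis sigma_at1 : forall u, phi (sigma u).[1] = u.[1].
Hypothesis sigma_mul : forall u v,
  exists2 w, sigma w = sigma u * sigma v & w.[0] = u.[0] * v.[0].

(** [sigma] embeds N[t] in A[t] as a lattice that is stable under products,
becomes A at t = 1, and whose product reduces to that of N at t = 0.  The
transported product inherits associativity and bilinearity from A[t]. *)
Lemma deforms_into_of_lattice : deforms_into N A.
Proof.
have /choice [mu muP] (uv : {poly N} * {poly N}) : exists w,
    sigma w = sigma uv.1 * sigma uv.2 /\ w.[0] = uv.1.[0] * uv.2.[0].
  by have [w ? ?] := sigma_mul uv.1 uv.2; exists w.
have muE u v : sigma (mu (u, v)) = sigma u * sigma v by case: (muP (u, v)).
exists (fun u v => mu (u, v)); split.
  split=> [p u u' v|p u v v'|u v w|u v]; last by case: (muP (u, v)).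
  - apply: sigma_inj; rewrite sigma_linear !muE sigma_linear mulrDl.
    by rewrite /poly_scale mulrA.
  - apply: sigma_inj; rewrite sigma_linear !muE sigma_linear mulrDr /poly_scale.
    by rewrite mulrA -scalC -mulrA.
  - by apply: sigma_inj; rewrite !muE mulrA.
exists 1; split; first exact: oner_neq0.
exists phi; split=> // a b.
have [psi psiK phiK] := phi_bij.
have constE u : (sigma (phi u)%:P).[1] = u.
  by apply: (can_inj psiK); rewrite sigma_at1 hornerC.
rewrite /deformed_mul; set w := mu _.
have -> : \sum_(i < size w) 1 ^+ i *: w`_i = w.[1].
  by rewrite horner_coef; apply: eq_bigr => i _; rewrite !expr1n scale1r mulr1.
rewrite -sigma_at1 muE hornerM_comm ?constE //.
by rewrite /comm_poly mul1r mulr1.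
Qed.
End Degeneration.

Section ReesDeformation.
Variables (K : comNzRingType) (A N : algType K) (x y : A) (xN yN : N).
Local Notation nfA := (nf (in_alg A) x y).
Local Notation nfN := (nf (in_alg N) xN yN).
Local Notation X := (rees_gen x 2).
Local Notation Y := (rees_gen y 3).
Local Notation nfR := (nf (map_poly (in_alg A)) X Y).
Local Notation nfNt := (nf (map_poly (in_alg N)) xN%:P yN%:P).
Hypothesis N_rel : family_rel 0 xN yN.
Hypothesis nfN_inj : injective nfN.
Hypothesis nfN_surj : forall n, spanned (in_alg N) xN yN n.
Hypothesis nfA_bij : bijective nfA.
Hypothesis A_rel : family_rel 1 x y.

(** The scalars of A[t] * N as a ring over K[t], where t acts on N by 0. *)
Definition rees_const (p : {poly K}) : {poly A} * N :=
  (map_poly (in_alg A) p, in_alg N p`_0).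

Lemma rees_const_is_zmod_morphism : zmod_morphism rees_const.
Proof. by move=> p q; rewrite /rees_const coefB !rmorphB. Qed.

Lemma rees_const_is_monoid_morphism : monoid_morphism rees_const.
Proof.
split=> [|p q]; rewrite /rees_const; first by rewrite coef1 !rmorph1.
by rewrite coef0M !rmorphM.
Qed.

HB.instance Definition _ := GRing.isZmodMorphism.Build {poly K}
  ({poly A} * N)%type rees_const rees_const_is_zmod_morphism.
HB.instance Definition _ := GRing.isMonoidMorphism.Build {poly K}
  ({poly A} * N)%type rees_const rees_const_is_monoid_morphism.

(** The product of the lattice and its reduction at t = 0 are computed together,
by rewriting in the ring A[t] * N: there the pairs (X, xN) and (Y, yN) satisfy
the relations with parameter (t^5, 0). *)
Lemma rees_mul (a b : 'M[{poly K}]_3) :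
  exists2 c, nfR c = nfR a * nfR b
           & (nfNt c).[0] = (nfNt a).[0] * (nfNt b).[0].
Proof.
pose nfP := nf rees_const (X, xN) (Y, yN).
have nfP1 d : (nfP d).1 = nfR d.
  exact: (rmorph_nf (f := fst) (rho' := map_poly (in_alg A))).
have nfP2 d : (nfP d).2 = (nfNt d).[0].
  rewrite nf_poly_at0 -nf_comp.
  exact: (rmorph_nf (f := snd) (rho' := in_alg N \o coefp 0)).
have X5E : rees_const 'X^5 = (map_poly (in_alg A) 'X^5, 0).
  by rewrite /rees_const coefXn rmorph0.
have rhoC p s : rees_const p * s = s * rees_const p.
  by case: s => u n; congr pair; [exact: scalC | exact: in_algC].
have relP : family_rel (rees_const 'X^5) (X, xN) (Y, yN).
  have [Xxy Xx3 Xy3] := rees_rel A_rel; have [Nxy Nx3 Ny3] := N_rel.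
  by rewrite X5E; split; congr pair.
have [c cE] := spannedM rhoC relP
  (ex_intro _ a erefl) (ex_intro _ b erefl).
exists c.
  by have := congr1 fst cE; rewrite nfP1 => ->; congr (_ * _); exact: nfP1.
by have := congr1 snd cE; rewrite nfP2 => ->; congr (_ * _); exact: nfP2.
Qed.

(** [phi] matches the monomials of A with those of N; so does the embedding
[nfR \o crd] of N[t] in A[t], with [crd] the coordinates over K[t]. *)
Lemma deforms_into_of_generators : deforms_into N A.
Proof.
have nfNt_inj := nf_poly_inj nfN_inj.
have /choice [crd crdK] := nf_poly_surj nfN_surj.
have nfK : cancel nfNt crd by move=> a; apply: nfNt_inj; rewrite crdK.
have [g gK nfAK] := nfA_bij.
have phi_lin : linear (nfN \o g).
  move=> k u v; rewrite /= -nf_linear; congr nf.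
  by apply: (can_inj gK); rewrite nfAK nf_linear !nfAK.
pose phi : {linear A -> N} := HB.pack (nfN \o g)
  (GRing.isLinear.Build _ _ _ _ _ phi_lin).
have phi_bij : bijective phi.
  have /choice [h hK] := nfN_surj.
  exists (nfA \o h) => u /=; last by rewrite gK hK.
  by rewrite -[RHS]nfAK; congr nf; apply: nfN_inj; rewrite hK.
apply: (@deforms_into_of_lattice _ _ _ phi (nfR \o crd)) => //.
- apply: inj_comp; last exact: can_inj crdK.
  exact/nf_rees_inj/bij_inj.
- move=> p u v /=; rewrite /poly_scale.
  rewrite -nfZ -raddfD /=; congr nf; apply: nfNt_inj.
  by rewrite raddfD /= nfZ !crdK.
- by move=> u /=; rewrite nf_rees_at1 gK -nf_poly_at1 crdK.
- move=> u v; have [c cE c0] := rees_mul (crd u) (crd v).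
  by exists (nfNt c); rewrite /= ?nfK // c0 !crdK.
Qed.
End ReesDeformation.

(** * A basis of N *)

Section PresentedAlgebra.
Variable K : comNzRingType.
Local Notation F := (free_algebra K 'I_2).
Local Notation vx := (free_var K (ord0 : 'I_2)).
Local Notation vy := (free_var K (ord_max : 'I_2)).
Local Notation proj := (@quot_map K F (@N_ideal K)).

Definition xN : algN K := proj vx.
Definition yN : algN K := proj vy.

Lemma N_relations_ideal u : @N_relations K u -> u \in @N_ideal K.
Proof. by move=> hu; apply/ideal_genP => J _; apply. Qed.

Lemma N_rel : family_rel 0 xN yN.
Proof.
rewrite /family_rel mul0rn mul0r oppr0 /xN /yN.
split; rewrite -?rmorphM -?rmorphXn -?rmorphD;
  apply: quot_map_ideal; apply: N_relations_ideal.
- by left; left.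
- by left; right.
- by right.
Qed.

Lemma proj_scal k : proj k%:A = in_alg (algN K) k.
Proof. by rewrite quot_mapZ rmorph1. Qed.

Lemma nfN_surj (n : algN K) : spanned (in_alg (algN K)) xN yN n.
Proof.
have [u <-] := quot_map_surj n.
have rel : family_rel (in_alg (algN K) 0) xN yN.
  by rewrite rmorph0; exact: N_rel.
exact: (spanned_free_algebra (@in_algC _ _) rel proj_scal erefl erefl).
Qed.

Section Independence.
Variables (A : algType K) (x y : A).
Local Notation scal := (map_poly (in_alg A)).
Local Notation X := (rees_gen x 2).
Local Notation Y := (rees_gen y 3).
Hypothesis nf_inj : injective (nf (in_alg A) x y).
Hypothesis A_rel : family_rel 1 x y.

(** Send the free algebra to A[t] by the Rees generators.  Its image lies in the
lattice W spanned by the X^i Y^j, so the preimage [J] of t W is an ideal; it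
contains the relations of N, each of which becomes a multiple of t^5.  If a
combination of monomials with coefficients in K vanishes in N, then it lies in
t W, and comparing coefficients at t = 0 shows that it is trivial. *)
Lemma nfN_inj : injective (nf (in_alg (algN K)) xN yN).
Proof.
apply: raddf_inj => a a0.
have [ev [evC evV]] := @free_algebra_lift K 'I_2 _ (scal \o polyC)
  (fun i => if i == ord0 then X else Y) (fun k s => @scalC K A k%:P s).
have evx : ev vx = X by rewrite evV.
have evy : ev vy = Y by rewrite evV.
have relX := rees_rel A_rel; have [xyX x3X y3X] := relX.
have X5 : scal 'X^5 = scal 'X * scal 'X^4 by rewrite -rmorphM -exprS.
have sp_ev := spanned_free_algebra (@scalC K A) relX evC evx evy.
have ev_xy : ev (vx * vy + vy * vx) = scal 'X^5 *+ 2.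
  rewrite -xyX -evx -evy.
  exact: etrans (rmorphD ev _ _)
                (congr2 +%R (rmorphM ev vx vy) (rmorphM ev vy vx)).
have ev_x3 : ev (vx ^+ 3 + vy ^+ 2) = 0.
  rewrite -x3X -evx -evy.
  exact: etrans (rmorphD ev _ _)
                (congr2 +%R (rmorphXn ev 3 vx) (rmorphXn ev 2 vy)).
have ev_y3 : ev (vy ^+ 3) = - (scal 'X^5 * X ^+ 2).
  by rewrite -y3X rmorphXn evy.
pose J u := exists b, ev u = scal 'X * nf scal X Y b.
pose u := nf (in_alg F) vx vy a.
have /ideal_genP/(_ J) : u \in @N_ideal K.
  apply: quot_map_eq0; rewrite -a0.
  by apply: (rmorph_nf (f := proj)) => k; exact: proj_scal.
case=> [|v|b].
- split=> [|v w [b vE] [c wE]|v w [b wE]|v w [b vE]].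
  + by exists 0; rewrite rmorph0 raddf0 mulr0.
  + by exists (b - c); rewrite rmorphB vE wE raddfB mulrBr.
  + have [c cE] := spannedM (@scalC K A) relX (sp_ev v) (ex_intro _ b erefl).
    by exists c; rewrite rmorphM wE cE mulrA -scalC mulrA.
  + have [c cE] := spannedM (@scalC K A) relX (ex_intro _ b erefl) (sp_ev w).
    by exists c; rewrite rmorphM vE cE mulrA.
- case=> [[->|->]|->].
  + exists ('X^4 *+ 2 *: delta_mx 0 0); rewrite ev_xy.
    by rewrite nfZ nf_delta !expr0 !mulr1 rmorphMn mulrnAr -X5.
  + by exists 0; rewrite ev_x3 raddf0 mulr0.
  + exists (- ('X^4 *: delta_mx ord_max 0)); rewrite ev_y3.
    rewrite raddfN /= nfZ nf_delta expr0 mulr1 mulrN; congr (- _).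
    by rewrite [RHS]mulrA -X5.
have -> : ev u = nf scal X Y (map_mx polyC a).
  rewrite -nf_comp -evx -evy; apply: rmorph_nf => k; exact: evC.
rewrite -nfZ => /(nf_rees_inj nf_inj)/matrixP ab.
apply/matrixP => i j; have /polyP/(_ 0%N) := ab i j.
by rewrite !mxE coefC coefXM.
Qed.

End Independence.
End PresentedAlgebra.

(** * A basis of M_2(K) + K^5 *)

Section Generators.
Variable K : fieldType.

Definition matx : 'M[K]_2 := delta_mx 0 1.
Definition maty : 'M[K]_2 := 2 *: delta_mx 1 0.

Lemma mat_xyE : matx * maty = 2 *: delta_mx 0 0.
Proof. by rewrite /matx /maty -scalerAr -mulmxE mul_delta_mx. Qed.

Lemma mat_xy : matx * maty + maty * matx = 1 *+ 2.
Proof.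
rewrite mat_xyE /matx /maty -scalerAl -mulmxE mul_delta_mx -scalerDr -scaler_nat.
congr (_ *: _); apply/matrixP => i j; rewrite !mxE.
by case: i => [[|[|//]] ?]; case: j => [[|[|//]] ?]; rewrite /= ?addr0 ?add0r.
Qed.

Lemma matx2 : matx ^+ 2 = 0.
Proof. by rewrite expr2 -mulmxE mul_delta_mx_cond. Qed.

Lemma maty2 : maty ^+ 2 = 0.
Proof.
by rewrite expr2 -scalerAl -scalerAr -mulmxE mul_delta_mx_cond !scaler0.
Qed.

Local Notation o k := (@Ordinal 3 k isT).

Lemma sum3E (V : nmodType) (F : 'I_3 -> V) :
  \sum_i F i = F (o 0) + F (o 1) + F (o 2).
Proof.
rewrite !big_ord_recl big_ord0 addr0 addrA.
by congr (F _ + F _ + F _); apply: val_inj.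
Qed.

(** Every monomial containing [matx ^+ 2] or [maty ^+ 2] vanishes: only 1, x, y
and xy are seen by the 2-dimensional representation. *)
Lemma nf_mat a :
  nf (in_alg _) matx maty a =
  a (o 0) (o 0) *: 1 + a (o 1) (o 0) *: delta_mx 0 1
  + (2 * a (o 0) (o 1)) *: delta_mx 1 0 + (2 * a (o 1) (o 1)) *: delta_mx 0 0.
Proof.
rewrite /nf !sum3E /= matx2 maty2 !(mulr0, mul0r, addr0).
rewrite !expr0 !expr1 !mul1r !mulr1.
rewrite mat_xyE /maty !mulr_algl !scalerA !(mulrC 2) addrA; congr (_ + _).
by rewrite -!addrA; congr (_ + _); rewrite addrC.
Qed.

Variable w : 'I_5 -> K.
Hypothesis w5 : forall k, w k ^+ 5 = -1.
Hypothesis w_inj : injective w.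
Hypothesis K2 : (2 : K) != 0.

(** The scalar components are given by a function of the five points, on which
the operations of the algebra are pointwise. *)
Definition elt (m : 'M[K]_2) (f : 'I_5 -> K) : algA K :=
  (m, (f (inord 0), f (inord 1), f (inord 2), f (inord 3), f (inord 4))).

Lemma elt_ext m m' f f' : m = m' -> f =1 f' -> elt m f = elt m' f'.
Proof. by move=> -> ff'; rewrite /elt !ff'. Qed.

Lemma eltD m m' f f' : elt m f + elt m' f' = elt (m + m') (fun k => f k + f' k).
Proof. by []. Qed.

Lemma eltN m f : - elt m f = elt (- m) (fun k => - f k).
Proof. by []. Qed.

Lemma eltM m m' f f' : elt m f * elt m' f' = elt (m * m') (fun k => f k * f' k).
Proof. by []. Qed.

Lemma eltZ c m f : c *: elt m f = elt (c *: m) (fun k => c * f k).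
Proof. by []. Qed.

Lemma elt0 : 0 = elt 0 (fun=> 0).
Proof. by []. Qed.

Lemma elt1 : 1 = elt 1 (fun=> 1).
Proof. by []. Qed.

Lemma eltX m f n : elt m f ^+ n = elt (m ^+ n) (fun k => f k ^+ n).
Proof.
elim: n => [|n IH]; first by rewrite expr0 elt1.
by rewrite exprS IH eltM; apply: elt_ext => [|k]; rewrite exprS.
Qed.

Lemma eltS (m : 'I_3 -> 'M[K]_2) (f : 'I_3 -> 'I_5 -> K) :
  \sum_i elt (m i) (f i) = elt (\sum_i m i) (fun k => \sum_i f i k).
Proof.
by rewrite sum3E !eltD; apply: elt_ext => [|k]; rewrite sum3E.
Qed.

Lemma in_alg_elt c : in_alg (algA K) c = elt (in_alg _ c) (fun=> c).
Proof. by rewrite /= elt1 eltZ; apply: elt_ext => // k; rewrite mulr1. Qed.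

Definition genx : algA K := elt matx w.

(** As w^5 = -1, the scalar components - w^4 are those of the inverse of w. *)
Definition geny : algA K := elt maty (fun k => - w k ^+ 4).

Lemma gen_rel : family_rel 1 genx geny.
Proof.
rewrite /family_rel mul1r; split.
- rewrite !eltM eltD mulr2n elt1 eltD -mulr2n -mat_xy; apply: elt_ext => // k.
  by rewrite mulrN mulNr -exprS -exprSr w5 opprK.
- rewrite !eltX eltD elt0; apply: elt_ext => [|k].
    by rewrite exprS matx2 maty2 mulr0 addr0.
  by rewrite sqrrN -exprM (exprD _ 5 3) w5 mulN1r subrr.
- rewrite !eltX eltN; apply: elt_ext => [|k].
    by rewrite exprS matx2 maty2 mulr0 oppr0.
  rewrite exprNn -exprM -signr_odd expr1 mulN1r.
  by rewrite (exprD _ (5 * 2) 2) exprM w5 sqrrN expr1n mul1r.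
Qed.

Lemma nf_gen a : nf (in_alg (algA K)) genx geny a =
  elt (nf (in_alg _) matx maty a)
      (fun k => nf idfun (w k) (- w k ^+ 4) a).
Proof.
rewrite -eltS; apply: eq_bigr => i _.
rewrite -eltS; apply: eq_bigr => j _.
rewrite [X in X * _](in_alg_elt (a i j)) (eltX matx) (eltX maty).
by rewrite (eltM (matx ^+ i)) eltM.
Qed.

(** At x = w, y = 1/w the monomial x^i y^j is w^(i - j), where i - j runs from -2
to 2; multiplying by w^2 makes the combination a polynomial of degree at most 4
in w. *)
Definition point_poly (a : 'M[K]_3) : {poly K} :=
  Poly [:: a (o 0) (o 2); a (o 0) (o 1) + a (o 1) (o 2);
           a (o 0) (o 0) + a (o 1) (o 1) + a (o 2) (o 2);
           a (o 1) (o 0) + a (o 2) (o 1); a (o 2) (o 0)].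

Lemma nf_point k a :
  w k ^+ 2 * nf idfun (w k) (- w k ^+ 4) a = (point_poly a).[w k].
Proof.
rewrite horner_Poly /= /nf !sum3E /=.
have := w5 k; move: (w k) => z z5.
ring: z5.
Qed.

(** The five points force [point_poly a] = 0, which leaves one entry of [a] free
on each of the diagonals i - j = -1, 1 and two on i - j = 0; the entries seen by
the matrix component remove these. *)
Lemma gen_inj : injective (nf (in_alg (algA K)) genx geny).
Proof.
apply: raddf_inj => a; rewrite /= nf_gen elt0 => -[a0 e0 e1 e2 e3 e4].
have e k : nf idfun (w k) (- w k ^+ 4) a = 0.
  by case: k => [[|[|[|[|[|//]]]]] hk];
    [move: e0|move: e1|move: e2|move: e3|move: e4];
    congr (nf _ (w _) (- w _ ^+ 4) _ = 0); apply: val_inj; rewrite /= inordK.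
have p0 : point_poly a = 0.
  apply: (@roots_geq_poly_eq0 _ _ (codom w)).
  - by apply/allP => _ /codomP [k ->]; rewrite rootE -nf_point e mulr0.
  - by rewrite map_inj_uniq // enum_uniq.
  - by rewrite size_codom card_ord; apply: size_Poly.
have c n : (point_poly a)`_n = 0 by rewrite p0 coef0.
have := (c 0, c 1, c 2, c 3, c 4)%N; rewrite !coef_Poly /=.
move=> [[[[a02 a01] a00] a10] a20].
move: a0; rewrite nf_mat => /matrixP m.
have := (m 0 0, m 0 1, m 1 0, m 1 1); rewrite !mxE /=.
rewrite !(mulr0, mulr1, addr0, add0r) => -[[[m00 m01] m10] m11].
have eq0_of_double (z : K) : 2 * z = 0 -> z = 0.
  by move/eqP; rewrite mulf_eq0 (negPf K2) => /eqP.
move/eq0_of_double in m10.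
have a11 : a (o 1) (o 1) = 0 by apply: eq0_of_double; rewrite m11 add0r in m00.
rewrite m01 add0r in a10; rewrite m10 add0r in a01.
rewrite m11 a11 !add0r in a00.
by apply/matrixP => -[[|[|[|//]]] hi] [[|[|[|//]]] hj]; rewrite mxE;
  rewrite (bool_irrelevance hi isT) (bool_irrelevance hj isT).
Qed.

(** Both sides have dimension 9. *)
Lemma gen_bij : bijective (nf (in_alg (algA K)) genx geny).
Proof.
pose f : {linear 'M[K]_3 -> algA K} := HB.pack (nf (in_alg (algA K)) genx geny)
  (GRing.isLinear.Build _ _ _ _ _ (@nf_linear K (algA K) genx geny)).
have : (limg (linfun f) == fullv)%VS.
  rewrite eqEdim subvf /= limg_dim_eq ?dimvf //.
  apply/eqP; rewrite capfv; apply/lker0P => u v.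
  by have fE := lfunE f; rewrite !fE; apply: gen_inj.
move=> /eqP im_f.
have /choice [g gK] u : exists a, nf (in_alg (algA K)) genx geny a = u.
  have : u \in limg (linfun f) by rewrite im_f memvf.
  by move=> /memv_imgP [a _ ->]; exists a; rewrite lfunE.
by exists g => // a; apply: gen_inj.
Qed.
End Generators.

Section RootsOfMinusOne.
Variable K : closedFieldType.

Lemma fifth_roots : (5 : K) != 0 -> exists w : 'I_5 -> K,
  injective w /\ forall k, w k ^+ 5 = -1.
Proof.
move=> K5.
pose p : {poly K} := 'X^5 + 1.
have p_lead : p = 'X^5 - (-1)%:P by rewrite polyCN opprK polyC1.
have szp : size p = 6%N by rewrite p_lead size_XnsubC.
have p_monic : p \is monic by rewrite p_lead monicXnsubC.
have [r pE] := closed_field_poly_normal p.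
rewrite (monicP p_monic) scale1r in pE.
have szr : size r = 5%N.
  by apply: succn_inj; rewrite -szp pE size_prod_XsubC.
have r_uniq : uniq r.
  rewrite -separable_prod_XsubC -pE unlock.
  apply/Bezout_eq1_coprimepP.
  (* p is separable because p - (X / 5) p' = 1 *)
  exists (1, - (5^-1 *: 'X)) => /=.
  rewrite /p derivD derivXn derivC addr0 mulNr mul1r -scaler_nat.
  rewrite -scalerAl -scalerAr scalerA mulVf // scale1r -exprS.
  by rewrite addrAC subrr add0r.
have rP (k : 'I_5) : r`_k ^+ 5 = -1.
  have : root p r`_k.
    by rewrite pE root_prod_XsubC mem_nth // szr.
  by rewrite rootE !hornerE addr_eq0 => /eqP.
exists (fun k : 'I_5 => r`_k); split=> [k l /eqP|//].
by rewrite nth_uniq ?szr // => /eqP/val_inj.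
Qed.
End RootsOfMinusOne.

Theorem theorem4p1 (R : realType) : deforms_into (algN R[i]) (algA R[i]).
Proof.
have [w [w_inj w5]] := fifth_roots (K := R[i]) (lt0r_neq0 (ltr0Sn _ 4)).
have bij := gen_bij w5 w_inj (lt0r_neq0 (ltr0Sn _ 1)).
apply: (@deforms_into_of_generators _ _ (algN R[i]) _ _ (xN _) (yN _)).
- exact: N_rel.
- exact: nfN_inj (bij_inj bij) (gen_rel w5).
- exact: nfN_surj.
- exact: bij.
- exact: gen_rel.
Qed.
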